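(* Let $\mathcal{G}$ be the set of (isomorphism classes of) virtual link diagrams, and write $\bigcirc\in\mathcal{G}$ for the loop without crossings. If $f:\mathcal{G}\to\mathbb{R}$ is multiplicative and weakly reflection positive, then $f(\bigcirc)$ belongs to $\{\ldots,-6,-4,-2,0,1,2,3,\ldots\}$; that is, $f(\bigcirc)$ is either a nonnegative integer or a negative even integer.
   Context: Notation: $\mathbb{Z}_+=\{0,1,2,\dots\}$. Virtual link diagrams. A virtual link diagram is a finite undirected 4-regular graph $G$ (loops and multiple edges allowed, and also components $\bigcirc$ consisting of a single closed edge without any vertex, called free loops here), together with, at each vertex $v$, a cyclic order of the four half-edges at $v$ and one pair of opposite half-edges (with respect to this cyclic order) labeled ''overcrossing''. Vertices are called crossings. Equivalently: there is a finite set $V$ of crossings; each $v\in V$ has four half-edges $(v,1),(v,2),(v,3),(v,4)$, in clockwise order, with $(v,1),(v,3)$ the overcrossing pair; this numbering at $v$ is determined only up to the simultaneous exchange $1\leftrightarrow3,\ 2\leftrightarrow4$; the edges are given by a perfect matching on the set of all $4|V|$ half-edges, together with a number $t\in\mathbb{Z}_+$ of free loops. Two diagrams are the same if they are isomorphic (the isomorphism preserving cyclic orders and overcrossing pairs). $\mathcal{G}$ is the set of virtual link diagrams up to isomorphism; $\emptyset$ is the diagram with no crossings and no edges; $G\sqcup H$ is disjoint union. (Functions $f$ on $\mathcal{G}$ are not assumed invariant under Reidemeister moves.) $k$-join. Let $\mathbb{R}\mathcal{G}$ be the space of formal $\mathbb{R}$-linear combinations of elements of $\mathcal{G}$; any function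 on $\mathcal{G}$ with values in a linear space is extended linearly to $\mathbb{R}\mathcal{G}$. For $k\in\mathbb{Z}_+$ and $G,H\in\mathcal{G}$, the $k$-join $G\overset{k}{\vee}H\in\mathbb{R}\mathcal{G}$ is the sum, over all ordered $k$-tuples $(u_1,\dots,u_k)$ of distinct crossings of $G$ and all ordered $k$-tuples $(v_1,\dots,v_k)$ of distinct crossings of $H$, of the element of $\mathbb{R}\mathcal{G}$ obtained from $G\sqcup H$ by carrying out for each $i=1,\dots,k$ the following: delete the crossings $u_i$ and $v_i$, leaving four open ends each, and replace by $\frac12(\text{first}+\text{second})$, where in the first term the open end at half-edge $j$ of $u_i$ is connected to the open end at half-edge $j$ of $v_i$ for $j=1,2,3,4$, and in the second term the open ends at half-edges $1,2,3,4$ of $u_i$ are connected to those at half-edges $3,4,1,2$ of $v_i$, respectively (expanded multilinearly over $i$, so each choice of tuples gives $2^{-k}$ times a sum of $2^k$ diagrams). Closed curves containing no remaining crossing become copies of $\bigcirc$. For $k=0$ this is $G\sqcup H$; if $G$ or $H$ has fewer than $k$ crossings it is $0$. Weak reflection positivity. $f:\mathcal{G}\to\mathbb{R}$ is weakly reflection positive if for each $k\in\mathbb{Z}_+$ the $\mathcal{G}\times\mathcal{G}$ matrix $M_{f,k}=(f(G\overset{k}{\vee}H))_{G,H\in\mathcal{G}}$ is positive semidefinite (i.e. symmetric with all finite principal submatrices positive semidefinite). Multiplicativity. $f:\mathcal{G}\to\mathbb{R}$ is multiplicative if $f(\emptyset)=1$ and $f(G\sqcup H)=f(G)f(H)$ for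 all $G,H\in\mathcal{G}$. *)

(* Defs.v *)
From mathcomp Require Import all_boot all_order all_algebra.
From mathcomp Require Import reals zify.

Set Implicit Arguments.
Unset Strict Implicit.
Unset Printing Implicit Defensive.

Import Order.TTheory GRing.Theory Num.Theory.
Local Open Scope ring_scope.

(* The four half-edges at a crossing [v] are [(v, 0)], [(v, 1)], [(v, 2)],
   [(v, 3)] in clockwise order, the overcrossing pair being [(v, 0)], [(v, 2)].
   [mate x] is the other half-edge of the edge containing [x], and [loops] is
   the number of edges without any vertex. *)
Record diagram := Diagram {
  crossing :> finType;
  mate : crossing * 'Z_4 -> crossing * 'Z_4;
  loops : nat;
  mateK : involutive mate;
  mate_neq : forall x, mate x != x
}.

Notation halfedge G := (crossing G * 'Z_4)%type.

Definition turn (b : bool) (j : 'Z_4) : 'Z_4 := if b then j + 2 else j.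

(* [t v] records whether the numbering of the half-edges at [v] is changed by
   the simultaneous exchange of the two over-ends and of the two under-ends. *)
Definition isomorphic (G H : diagram) : Prop :=
  exists (p : G -> H) (t : G -> bool),
    let p' (x : halfedge G) : halfedge H := (p x.1, turn (t x.1) x.2) in
    [/\ bijective p, forall x, mate (p' x) = p' (mate x) & loops G = loops H].

Lemma turnK b : involutive (turn b).
Proof. by case: b => j //=; apply/val_inj; case: j => -[|[|[|[|]]]]. Qed.

Section FreeLoops.
Variable t : nat.
Definition void_mate (x : void * 'Z_4) := x.

Fact void_mateK : involutive void_mate. Proof. by []. Qed.
Fact void_mate_neq x : void_mate x != x. Proof. by case: x => -[]. Qed.

Definition free_loops : diagram := Diagram t void_mateK void_mate_neq.
End FreeLoops.

Definition empty_diagram : diagram := free_loops 0.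
Definition circle : diagram := free_loops 1.

Section DisjointUnion.
Variables G H : diagram.

Definition union_mate (x : (G + H) * 'Z_4) : (G + H) * 'Z_4 :=
  match x with
  | (inl g, j) => let y := mate (g, j) in (inl y.1, y.2)
  | (inr h, j) => let y := mate (h, j) in (inr y.1, y.2)
  end.

Fact union_mateK : involutive union_mate.
Proof. by case=> -[] c j /=; rewrite -surjective_pairing mateK. Qed.

Fact union_mate_neq x : union_mate x != x.
Proof.
case: x => -[] c j /=; apply: contra_neq (mate_neq (c, j)) => -[];
  by case: mate => a b /= -> ->.
Qed.

Definition disjoint_union : diagram :=
  Diagram (loops G + loops H) union_mateK union_mate_neq.
End DisjointUnion.

(* Deleting the crossings in [del] and connecting the resulting open ends in
   pairs [x], [glue x]; surviving half-edges are fixed by [glue]. *)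
Section Surgery.
Variables (D : diagram) (del : {set D}) (glue : halfedge D -> halfedge D).
Hypothesis glueK : involutive glue.
Hypothesis glue_fix : forall x, (glue x == x) = (x.1 \notin del).

Definition surviving (x : halfedge D) := x.1 \notin del.

(* [step] jumps across the connection at an open end, then follows the edge. *)
Definition step (x : halfedge D) := mate (glue x).

Definition target (x : halfedge D) : halfedge D :=
  head x [seq y <- orbit step (mate x) | surviving y].

Definition surgery_mate (x : {c : D | c \notin del} * 'Z_4) :
    {c : D | c \notin del} * 'Z_4 :=
  let y := target (val x.1, x.2) in (insubd x.1 y.1, y.2).

(* The equivalence classes of half-edges under [connect adjacent] are the curves
   obtained by connecting the open ends; those without surviving half-edges are
   closed curves containing no remaining crossing. *)
Definition adjacent : rel (halfedge D) :=
  [rel x y | (y == mate x) || (y == glue x)].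

Definition closed_curves : nat :=
  #|[set [set y | connect adjacent x y]
      | x in [pred x | [forall y, connect adjacent x y ==> ~~ surviving y]]]|.

Lemma step_inj : injective step.
Proof. exact: inj_comp (inv_inj (@mateK D)) (inv_inj glueK). Qed.

Lemma glue_id x : surviving x -> glue x = x.
Proof. by rewrite /surviving -glue_fix => /eqP. Qed.

Lemma surviving_glue x : surviving (glue x) = surviving x.
Proof. by rewrite /surviving -!glue_fix glueK eq_sym. Qed.

Lemma targetP x : surviving x -> exists n,
  [/\ target x = iter n.+1 step x, surviving (target x) &
      forall m, (m < n)%N -> ~~ surviving (iter m.+1 step x)].
Proof.
move=> sx; have stx : mate x = step x by rewrite /step glue_id.
pose s := orbit step (step x); pose n := find surviving s.
have hs : has surviving s.
  apply/hasP; exists x => //; rewrite /s -fconnect_orbit.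
  by rewrite (fconnect_sym step_inj); apply: fconnect1.
have lt_n : (n < order step (step x))%N by rewrite -(size_orbit step) -has_find.
have nthE m : (m < order step (step x))%N -> nth x s m = iter m.+1 step x.
  move=> lt_m; rewrite (set_nth_default (step x)) ?size_orbit //.
  by rewrite /s /orbit nth_traject // iterSr.
have tE : target x = nth x s n.
  rewrite /target stx -/s /n; elim: (s) hs => //= y r IHr.
  by case: ifP.
exists n; rewrite tE nthE //; split=> // [|m lt_mn].
  by rewrite -nthE //; apply: nth_find.
by rewrite -nthE ?(ltn_trans lt_mn) //; rewrite /n in lt_mn;
  apply/negbT/before_find.
Qed.

Lemma target_uniq x n : surviving x -> surviving (iter n.+1 step x) ->
  (forall m, (m < n)%N -> ~~ surviving (iter m.+1 step x)) ->
  target x = iter n.+1 step x.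
Proof.
move=> sx sn min_n; have [m [tE sm min_m]] := targetP sx.
rewrite tE in sm *; case: (ltngtP m n) => [lt_mn|lt_nm|->] //.
- by have := min_n _ lt_mn; rewrite sm.
- by have := min_m _ lt_nm; rewrite sn.
Qed.

Lemma iter_glue m x : iter m step (glue (iter m step x)) = glue x.
Proof.
by elim: m => // m IHm; rewrite iterSr iterS {1}/step {1}/step glueK mateK IHm.
Qed.

Lemma iter_glue_le m n x : (m <= n)%N ->
  iter m step (glue (iter n step x)) = glue (iter (n - m) step x).
Proof. by move=> le_mn; rewrite -{1}(subnKC le_mn) iterD iter_glue. Qed.

Lemma target_surviving x : surviving x -> surviving (target x).
Proof. by move=> /targetP[n []]. Qed.

Lemma targetK x : surviving x -> target (target x) = x.
Proof.
move=> sx; have [n [tE sy min_n]] := targetP sx.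
have back m : (m <= n.+1)%N ->
    iter m step (target x) = glue (iter (n.+1 - m) step x).
  by move=> le_m; rewrite -iter_glue_le // -tE glue_id.
have yx : iter n.+1 step (target x) = x by rewrite back // subnn glue_id.
rewrite (@target_uniq _ n) ?yx // => m lt_mn.
by rewrite back 1?ltnW // subSS surviving_glue -subnSK //; apply: min_n; lia.
Qed.

Lemma target_neq x : surviving x -> target x != x.
Proof.
move=> sx; have [n [-> _ min_n]] := targetP sx; apply/eqP => xn.
have back m : (m <= n.+1)%N -> iter m step x = glue (iter (n.+1 - m) step x).
  by move=> le_m; rewrite -iter_glue_le // xn glue_id.
set m := n.+1./2; have le_m : (m <= n)%N by rewrite /m; lia.
have nE := odd_double_half n.+1; rewrite -/m -addnn in nE.
case: (odd n.+1) nE => /= nE.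
  have := back m.+1; rewrite (_ : n.+1 - m.+1 = m)%N; last by lia.
  by rewrite iterS {1}/step => /(_ le_m)/eqP; apply/negP/mate_neq.
have := back m; rewrite (_ : n.+1 - m = m)%N; last by lia.
move=> /(_ (leqW le_m))/esym/eqP; rewrite glue_fix -/(surviving _).
case: m le_m nE => [|m]; first by lia.
by move=> lt_mn _; apply/negP/(min_n _ lt_mn).
Qed.

Fact surgery_mateK : involutive surgery_mate.
Proof.
case=> c j; have sx : surviving (val c, j) := valP c.
rewrite /surgery_mate /= val_insubd (target_surviving sx : _ \notin _).
by rewrite -surjective_pairing targetK //= valKd.
Qed.

Fact surgery_mate_neq x : surgery_mate x != x.
Proof.
case: x => c j; have sx : surviving (val c, j) := valP c.
apply: contra_neq (target_neq sx) => -[/(congr1 val)].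
rewrite /= val_insubd (target_surviving sx : _ \notin _) => e1 e2.
by rewrite [LHS]surjective_pairing e1 e2.
Qed.

Definition surgery : diagram :=
  Diagram (loops D + closed_curves) surgery_mateK surgery_mate_neq.
End Surgery.

Notation injections k T := {u : {ffun 'I_k -> T} | injectiveb u}.

(* The term of the [k]-join in which the half-edges of the [i]-th chosen
   crossings [u i] of [G] and [v i] of [H] are connected according to the first
   ([s i = false]) or the second ([s i = true]) way. *)
Section JoinTerm.
Variables (G H : diagram) (k : nat) (u : injections k G) (v : injections k H).
Variable s : {ffun 'I_k -> bool}.

Lemma left_inj : injective (val u). Proof. by apply/injectiveP; case: u. Qed.
Lemma right_inj : injective (val v). Proof. by apply/injectiveP; case: v. Qed.

Definition join_del : {set disjoint_union G H} :=
  [set inl (val u i) | i : 'I_k] :|: [set inr (val v i) | i : 'I_k].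

Definition join_glue (x : halfedge (disjoint_union G H)) :
    halfedge (disjoint_union G H) :=
  match x with
  | (inl g, j) =>
      if [pick i | val u i == g] is Some i
      then (inr (val v i), turn (s i) j) else x
  | (inr h, j) =>
      if [pick i | val v i == h] is Some i
      then (inl (val u i), turn (s i) j) else x
  end.

Lemma pick_u i : [pick i' | val u i' == val u i] = Some i.
Proof. by case: pickP => [i' /eqP/left_inj-> //|/(_ i)]; rewrite eqxx. Qed.

Lemma pick_v i : [pick i' | val v i' == val v i] = Some i.
Proof. by case: pickP => [i' /eqP/right_inj-> //|/(_ i)]; rewrite eqxx. Qed.

Fact join_glueK : involutive join_glue.
Proof.
case=> -[] c j /=; case: pickP => [i /eqP<-|e] /=.
- by rewrite pick_v turnK.
- by case: pickP => // i; rewrite e.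
- by rewrite pick_u turnK.
- by case: pickP => // i; rewrite e.
Qed.

Fact join_glue_fix x : (join_glue x == x) = (x.1 \notin join_del).
Proof.
case: x => -[] c j /=; case: pickP => [i /eqP<-|e].
- by apply/esym/negbTE; rewrite negbK inE imset_f.
- rewrite eqxx; apply/esym; rewrite inE negb_or; apply/andP; split.
    by apply/imsetP => -[i _ [ci]]; have := e i; rewrite ci eqxx.
  by apply/imsetP => -[].
- by apply/esym/negbTE; rewrite negbK inE imset_f ?orbT.
- rewrite eqxx; apply/esym; rewrite inE negb_or; apply/andP; split.
    by apply/imsetP => -[].
  by apply/imsetP => -[i _ [ci]]; have := e i; rewrite ci eqxx.
Qed.

Definition join_term : diagram := surgery join_glueK join_glue_fix.
End JoinTerm.

(* Formal linear combinations are given by the list of their terms. *)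
Definition formal_sum (R : realType) : Type := seq (R * diagram).

Definition linear_ext (R : realType) (f : diagram -> R) (a : formal_sum R) : R :=
  \sum_(p <- a) p.1 * f p.2.

Definition kjoin (R : realType) (k : nat) (G H : diagram) : formal_sum R :=
  [seq (2^-1 ^+ k, join_term x.1.1 x.1.2 x.2)
    | x : injections k G * injections k H * {ffun 'I_k -> bool}].

(* The family [x] may have repetitions; these only merge coefficients of a
   vector supported on distinct indices. *)
Definition positive_semidefinite (R : realType) (T : Type) (M : T -> T -> R) :=
  (forall x y, M x y = M y x) /\
  forall (n : nat) (x : 'I_n -> T) (c : 'I_n -> R),
    0 <= \sum_(i < n) \sum_(j < n) c i * M (x i) (x j) * c j.

Definition weakly_reflection_positive (R : realType) (f : diagram -> R) :=
  forall k : nat,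
    positive_semidefinite (fun G H => linear_ext f (kjoin R k G H)).

Definition multiplicative_on_diagrams (R : realType) (f : diagram -> R) :=
  f empty_diagram = 1 /\
  forall G H, f (disjoint_union G H) = f G * f H.

(* A function on isomorphism classes is an invariant function on [diagram]. *)
Definition isomorphism_invariant (R : realType) (f : diagram -> R) :=
  forall G H, isomorphic G H -> f G = f H.

(* Main.v *)
Require Import Defs.
From mathcomp Require Import all_boot all_order all_algebra all_fingroup.
From mathcomp Require Import reals zify ring lra.
Set Implicit Arguments.
Unset Strict Implicit.
Unset Printing Implicit Defensive.
Import Order.TTheory GRing.Theory Num.Theory.
Local Open Scope ring_scope.

(** Diagrams with [k] crossings and no free loop are the perfect matchings of
    the [4k] half-edges. The [k]-join of two of them deletes all crossings, so
    with [x = f circle] its value is, up to a positive factor, the sum of [x ^ c(M, N^g)], where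
    [c(M, N)] is the number of closed curves of the union of [M] and [N], and [g]
    runs over the group of permutations of the half-edges induced by
    renumbering the crossings. Hence the form
    [sum_(M, N) w(M) w(N) x ^ c(M, N)] is nonnegative for every weight [w] on
    matchings that is invariant under this group.

    Let [n = 2k]. Four weights suffice:
    - the constant one gives [F_n >= 0], where [F_r = x (x + 2) ... (x + 2r - 2)];
    - the signed number of edges joining opposite half-edges of a crossing
      (over-ends counted [+], under-ends [-]) gives [F_(n-1) (x - 1) >= 0];
    - the sign of [M], if all edges of [M] join an over-end to an under-end (so
      that [M] is a permutation), and [0] otherwise, gives [E_n >= 0], where
      [E_r = x (x - 1) ... (x - r + 1)];
    - the same sign times the number of fixed points of that permutation gives
      [E_(n-1) (2x - n + 2) >= 0].
    For [x < 0] and [n] large the first two force [F_(n-1) = 0], so that [x] is a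
    negative even integer; for [m < x < m + 1] the third one fails at [n = m + 2]
    if [m] is even, and the fourth one at [n = m + 3] if [m] is odd. *)

(** * Sums over the perfect matchings of a finite set *)

Lemma card_porbitsV (T : finType) (s : {perm T}) : #|porbits s^-1| = #|porbits s|.
Proof. by congr #|pred_of_set _|; apply: eq_imset => x; apply: porbitV. Qed.

Section Matchings.
Variables (T : finType).
Implicit Types (e : rel T) (M N s : {perm T}) (a b z : T) (C : {set T}).

Definition matchings e : {set {perm T}} :=
  [set s : {perm T} | (s * s == 1)%g && [forall z, e z (s z)]].

Lemma matchingsP e s :
  reflect (involutive s /\ forall z, e z (s z)) (s \in matchings e).
Proof.
rewrite inE; apply: (iffP andP) => -[h1 h2].
  by split=> z; [rewrite -permM (eqP h1) perm1 | apply: (forallP h2)].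
split; last exact/forallP.
by apply/eqP/permP => z; rewrite permM h1 perm1.
Qed.

(* Each closed curve of the union of [M] and [N] alternates between their edges
   and splits into two orbits of [N * M], one for each direction. *)
Definition curves M N : nat := #|porbits (N * M)%g|./2.

Lemma invol_invg s : involutive s -> s^-1%g = s.
Proof. by move=> sK; apply/permP => z; apply: (@perm_inj _ s); rewrite permKV sK. Qed.

Lemma involutive_sq s : involutive s -> (s * s = 1)%g.
Proof. by move=> sK; apply/permP => z; rewrite permM sK perm1. Qed.

Lemma curves_refl M : involutive M -> curves M M = #|T|./2.
Proof.
move=> MK; rewrite /curves involutive_sq //.
congr _./2; rewrite card_imset // => x y /setP/(_ x).
by rewrite porbit_id => /esym /porbitP[i ->]; rewrite expg1n perm1.
Qed.

Lemma conj_tpermE N a b z : (N ^ tperm a b)%g z = tperm a b (N (tperm a b z)).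
Proof. by rewrite conjgE tpermV !permM. Qed.

(* Exchanging [M a] and [N a] in [N] makes the edge at [a] common to [M] and [N],
   which cuts it off as a closed curve of its own. *)
Lemma curves_conj M N a : involutive M -> involutive N ->
    M a != a -> N a != a -> N a != M a ->
  curves M (N ^ tperm (M a) (N a))%g = (curves M N).+1.
Proof.
move=> MK NK Ma Na NMa; set b := N a in Na NMa *; set a' := M a in Ma NMa *.
have Nb : N b = a by rewrite NK.
have Ma' : M a' = a by rewrite MK.
pose s := (N * M)%g; pose u := tperm a (M b); pose t := tperm a' b.
have sb : s b = a' by rewrite permM Nb.
have sa : s a = M b by rewrite permM.
(* The conjugation multiplies [s] by two transpositions. Each of them exchanges two points of one
   orbit and so splits it; two new orbits make one new curve. *)
have tu : (N ^ t * M = t * (s * u))%g.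
  have -> : u = (t ^ M)%g by rewrite tpermJ Ma'.
  rewrite !conjgE tpermV (invol_invg MK) /s !mulgA; congr (_ * _)%g.
  rewrite -!mulgA; do 2!congr (_ * _)%g.
  by rewrite mulgA involutive_sq ?mul1g.
have Mb_a : a != M b by apply: contra_neq NMa => ab; rewrite /a' ab MK.
have e1 : #|porbits (s * u)%g| = #|porbits s|.+1.
  have := porbits_mul_tperm s^-1%g a (M b); rewrite /= -/u Mb_a.
  rewrite porbitV porbit_sym (_ : M b \in porbit s a) /=; last first.
    by rewrite -sa; apply: (mem_porbit s 1).
  have -> : (u * s^-1 = (s * u)^-1)%g.
      by rewrite (invMg s u) /u tpermV.
  by rewrite !card_porbitsV addn0 addn1.
have := porbits_mul_tperm (s * u)%g a' b; rewrite /= -/t -tu e1.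
have -> : a' \in porbit (s * u)%g b.
  have {1}-> : a' = (s * u)%g b; last exact: (mem_porbit _ 1).
  rewrite permM sb tpermD //; first by rewrite eq_sym.
  by apply: contra_neq Na => /(congr1 M); rewrite MK Ma'.
rewrite /= addn0 eq_sym NMa addn1 /curves -/s => ->.
by rewrite -addn2 halfD /=; lia.
Qed.

Lemma conjK s N : involutive N -> involutive (N ^ s)%g.
Proof.
by move=> NK z; rewrite -permM -conjMg involutive_sq // conj1g perm1.
Qed.

Definition agree M C N := [forall z in C, N z == M z].

Lemma agreeP M C N : reflect {in C, forall z, N z = M z} (agree M C N).
Proof. exact: 'forall_in_eqP. Qed.

Definition stable M C := forall z, (M z \in C) = (z \in C).

Section SumOverMatchings.
Variable e : rel T.
Hypothesis e_irr : irreflexive e.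
Hypothesis e_sym : symmetric e.
(* This holds for complete and for complete bipartite graphs. *)
Hypothesis e_multi : forall a x y z, e a x -> e a y -> e x z -> z != y -> e y z.

(** The conjugation replaces the edges [{a, y}] and [{x, N x}] by [{a, x}] and [{y, N x}]; the last
    pair is an edge by [e_multi]. *)
Lemma matching_conj N a x y : N \in matchings e -> e a x -> e a y -> x != y ->
  N a = y -> (N ^ tperm x y)%g \in matchings e.
Proof.
move=> /matchingsP[NK Ne] ax ay xy Na; apply/matchingsP; split=> [|z].
  exact: conjK.
have a_x : a != x by apply: contraTneq ax => ->; rewrite e_irr.
have a_y : a != y by apply: contraTneq ay => ->; rewrite e_irr.
have Ny : N y = a by rewrite -Na NK.
rewrite conj_tpermE; case: (tpermP x y z) => [-> |-> |/eqP zx /eqP zy].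
- by rewrite Ny tpermD ?[_ == a]eq_sym // e_sym.
- have Nx_y : N x != y by apply: contra_neq a_x => h; rewrite -Ny -h NK.
  rewrite tpermD 1?eq_sym //; first exact: (e_multi ax ay).
  by apply: contraTneq (Ne x) => ->; rewrite e_irr.
- case: tpermP => [Nz|Nz|_ _]; last exact: Ne.
    rewrite e_sym; apply: (e_multi ax ay) => //.
    by rewrite e_sym -Nz.
  by rewrite -(NK z) Nz Ny.
Qed.

Variable F : realFieldType.
Variables (M : {perm T}) (theta : {perm T} -> F) (d : nat) (x eps : F).
Hypothesis M_in : M \in matchings e.
(** The model is a sign times [x ^+ curves M N]: the exchange creates one curve and multiplies the
    sign by [eps]. *)
Hypothesis theta_conj : forall N a, N \in matchings e -> N a != M a ->
  x * theta N = eps * theta (N ^ tperm (M a) (N a))%g.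
(** Here [r.+1] edges of [M] are left outside [C]. The value of [d] is 2 for complete graphs and 1
    for complete bipartite ones. *)
Hypothesis degree : forall C a r, stable M C -> a \notin C ->
  (2 * r.+1 + #|C| = #|T|)%N -> #|[pred b | e a b & b \notin C]| = (d * r).+1.

(** Conjugation by the transposition of [M a] and [b] is a bijection between the two index sets: it
    moves the partner of [a] from [b] to [M a], and it respects agreement on [C], which it fixes
    pointwise. *)
Lemma sum_matchings_move C a b : stable M C -> a \notin C -> b \notin C ->
    e a b -> b != M a ->
  x * \sum_(N in matchings e | agree M C N && (N a == b)) theta N =
  eps * \sum_(N in matchings e | agree M C N && (N a == M a)) theta N.
Proof.
move=> stC aC bC ab bMa; have [MK Me] := matchingsP _ _ M_in.
have a_b : b != a by apply: contraTneq ab => ->; rewrite e_irr.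
have a_Ma : M a != a by apply: contraTneq (Me a) => ->; rewrite e_irr.
pose t := tperm (M a) b.
rewrite mulr_sumr (eq_bigr (fun N => eps * theta (N ^ t)%g)); last first.
  move=> N /and3P[Nin _ /eqP Na].
  by rewrite (theta_conj (a := a)) // Na.
rewrite mulr_sumr [RHS](reindex_inj (@conjg_inj _ t)) /=.
apply: eq_bigl => N.
have tt : ((N ^ t) ^ t = N)%g by rewrite -conjgM /t tperm2 conjg1.
have ta : t a = a by rewrite tpermD.
have Nta : (N ^ t)%g a = t (N a) by rewrite conj_tpermE -/t ta.
have -> : ((N ^ t)%g a == M a) = (N a == b).
  by rewrite Nta -(inj_eq (@perm_inj _ t)) tpermK tpermL.
have -> : agree M C (N ^ t)%g = agree M C N.
  apply: eq_forallb_in => z zC.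
  have tid w : w \in C -> t w = w.
    move=> wC; apply: tpermD; last by apply: contraNneq bC => ->.
    by apply: contraNneq aC => aw; rewrite -stC aw.
  rewrite conj_tpermE -/t (tid z) // -(inj_eq (@perm_inj _ t)) tpermK.
  by rewrite tid // stC.
case: (eqVneq (N a) b) => [Na|]; last by rewrite !andbF.
congr (_ && _); apply/idP/idP => [Nin|Ntin].
  by apply: (matching_conj Nin (Me a) ab) => //; rewrite eq_sym.
have := matching_conj Ntin ab (Me a) bMa; rewrite tpermC -/t tt; apply.
by rewrite Nta Na tpermR.
Qed.

(* Removes the edges of [M] outside [C] one by one: for a point [a] outside [C],
   [sum_matchings_move] reduces the matchings with [N a != M a] to those with
   [N a = M a]. *)
Lemma sum_matchings r C : stable M C -> (2 * r + #|C| = #|T|)%N ->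
  x ^+ r * \sum_(N in matchings e | agree M C N) theta N =
  (\prod_(i < r) (x + eps * (d * i)%:R)) * theta M.
Proof.
have [MK Me] := matchingsP _ _ M_in.
elim: r C => [|r IHr] C stC cardC.
  rewrite big_ord0 expr0 !mul1r (big_pred1 M) // => N.
  have Cfull z : z \in C.
    suff -> : C = setT by rewrite inE.
    by apply/eqP; rewrite eqEcard subsetT cardsT -cardC muln0 add0n /=.
  apply/andP/eqP => [[_ /agreeP NM]|->]; last by split=> //; apply/agreeP.
  by apply/permP => z; apply: NM.
have /existsP[a aC] : [exists a, a \notin C].
  rewrite -negb_forall; apply/negP => /forallP Cfull.
  suff : #|C| = #|T| by lia.
  by apply: eq_card => z; rewrite Cfull.
pose C' := a |: (M a |: C).
have a_Ma : M a != a by apply: contraTneq (Me a) => ->; rewrite e_irr.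
have MaC : M a \notin C by rewrite stC.
have stC' : stable M C'.
  move=> z; rewrite !inE stC (inj_eq (@perm_inj _ M)) (can2_eq MK MK).
  by rewrite orbCA.
have cardC' : (2 * r + #|C'| = #|T|)%N.
  rewrite /C' !cardsU1 !inE negb_or eq_sym a_Ma aC MaC -cardC /=; lia.
have := IHr C' stC' cardC'.
set S := \sum_(N in _ | agree M C' N) theta N => IH.
have S'E : \sum_(N in matchings e | agree M C N && (N a == M a)) theta N = S.
  apply: eq_bigl => N; case: (boolP (N \in _)) => //= /matchingsP[NK _].
  apply/andP/agreeP => [[/agreeP h /eqP Na] z|h].
    rewrite !inE => /or3P[/eqP->//|/eqP->|/h //].
    by rewrite MK -Na NK.
  split; last by rewrite h // !inE eqxx.
  by apply/agreeP => z zC; apply: h; rewrite !inE zC !orbT.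
(* Split by the partner of [a]: after multiplication by [x], the partner [M a] contributes [x * S]
   and each of the [d * r] others contributes [eps * S]. *)
have SE : x * \sum_(N in matchings e | agree M C N) theta N
    = (x + eps * (d * r)%:R) * S.
  rewrite (partition_big (fun N => N a) [pred b | e a b & b \notin C]) /=; last first.
    move=> N /andP[/matchingsP[NK Ne] /agreeP h]; rewrite Ne /=.
    apply: contra aC => /[dup] /h; rewrite NK => /(congr1 M); rewrite MK => <-.
    by rewrite stC.
  rewrite (bigD1 (M a)) /=; last by rewrite Me MaC.
  rewrite mulrDr mulrDl; congr (_ + _).
    by rewrite -S'E; congr (_ * _); apply: eq_bigl => N; rewrite andbA.
  rewrite mulr_sumr (eq_bigr (fun=> eps * S)); last first.
    move=> b /andP[/andP[ab bC] bMa]; rewrite -S'E -(sum_matchings_move stC aC bC) //.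
    by congr (_ * _); apply: eq_bigl => N; rewrite andbA.
  rewrite sumr_const -[LHS]mulr_natr [LHS]mulrAC; congr (_ * _%:R * _).
  have := degree stC aC cardC; rewrite (cardD1 (M a) [pred b | _ & _]) !inE Me MaC add1n => -[<-].
  by apply: eq_card => b; rewrite !inE andbC.
rewrite exprSr -mulrA SE mulrCA IH big_ord_recr /=.
by rewrite mulrCA mulrA.
Qed.

End SumOverMatchings.

Lemma agree_edge M N p : involutive M -> involutive N ->
  agree M [set p; M p] N = (N p == M p).
Proof.
move=> MK NK; apply/agreeP/eqP => [->//|h z]; first by rewrite !inE eqxx.
by rewrite !inE => /orP[/eqP->//|/eqP->]; rewrite MK -h NK.
Qed.

Lemma agreeU M N C1 C2 : agree M (C1 :|: C2) N = agree M C1 N && agree M C2 N.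
Proof.
apply/agreeP/andP => [h|[/agreeP h1 /agreeP h2] z].
  by split; apply/agreeP => z zC; apply: h; rewrite inE zC ?orbT.
by rewrite inE => /orP[/h1|/h2].
Qed.

Lemma stable_edge M p : involutive M -> stable M [set p; M p].
Proof. by move=> MK z; rewrite !inE (inj_eq perm_inj) (can2_eq MK MK) orbC. Qed.

Lemma stableU M C1 C2 : stable M C1 -> stable M C2 -> stable M (C1 :|: C2).
Proof. by move=> h1 h2 z; rewrite !inE h1 h2. Qed.

Lemma stable0 M : stable M set0.
Proof. by move=> z; rewrite !inE. Qed.

Lemma agree0 M N : agree M set0 N.
Proof. by apply/agreeP => z; rewrite inE. Qed.

(** * Quadratic forms in weights on matchings *)

Section QuadraticForm.
Variable e : rel T.
Hypothesis e_irr : irreflexive e.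
Hypothesis e_sym : symmetric e.
Hypothesis e_multi : forall a x y z, e a x -> e a y -> e x z -> z != y -> e y z.
Variables (F : realFieldType) (n d : nat) (x eps : F) (chi : {perm T} -> F).
Hypothesis cardT : #|T| = n.*2.
Hypothesis degree : forall M C a r, M \in matchings e -> stable M C ->
  a \notin C -> (2 * r.+1 + #|C| = #|T|)%N ->
  #|[pred b | e a b & b \notin C]| = (d * r).+1.
Hypothesis x_neq0 : x != 0.
Hypothesis eps_sq : eps * eps = 1.
Hypothesis chi_sq : forall N, N \in matchings e -> chi N * chi N = 1.
Hypothesis chi_conj : forall M N a, M \in matchings e -> N \in matchings e ->
  N a != M a -> chi (N ^ tperm (M a) (N a))%g = eps * chi N.

Definition curve_form (w : {perm T} -> F) : F :=
  \sum_(M in matchings e) \sum_(N in matchings e) w M * w N * x ^+ curves M N.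

(** For [d = 2], [s = 1] this is [F_r], and for [d = 1], [s = -1] it is [E_r]. At [y = s = 1] it is
    [(2r - 1)!!] or [r!], the number of matchings with [r] edges left to choose. *)
Definition rising (y : F) (s : F) r : F := \prod_(i < r) (y + s * (d * i)%:R).

Let theta M N := chi M * chi N * x ^+ curves M N.

Lemma matching_neq M a : M \in matchings e -> M a != a.
Proof.
by move=> /matchingsP[_ Me]; apply: contraTneq (Me a) => ->; rewrite e_irr.
Qed.

Lemma matchingK M : M \in matchings e -> involutive M.
Proof. by case/matchingsP. Qed.

Lemma card_edge M p : M \in matchings e -> #|[set p; M p]| = 2%N.
Proof. by move=> Min; rewrite cards2 eq_sym matching_neq. Qed.

Lemma theta_conj M N a : M \in matchings e -> N \in matchings e ->
  N a != M a -> x * theta M N = eps * theta M (N ^ tperm (M a) (N a))%g.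
Proof.
move=> Min Nin NM; rewrite /theta chi_conj // curves_conj ?matching_neq //;
  try exact: matchingK.
rewrite exprS; move: (x ^+ _) (chi M) (chi N) => y u v.
by rewrite -[LHS]mul1r -{1}eps_sq; ring.
Qed.

Lemma theta_refl M : M \in matchings e -> theta M M = x ^+ n.
Proof.
move=> Min; rewrite /theta chi_sq // curves_refl; last exact: matchingK.
by rewrite cardT doubleK mul1r.
Qed.

(** This is [sum_matchings] for the empty set, with [theta M M = x ^+ n] cancelled. The value does
    not depend on [M], so all rows of the form have the same sum. *)
Lemma sum_theta M : M \in matchings e ->
  \sum_(N in matchings e) theta M N = rising x eps n.
Proof.
move=> Min; have := @sum_matchings e e_irr e_sym e_multi F M (theta M) d x eps Min
  (fun N a => @theta_conj M N a Min) (fun C a r => @degree M C a r Min) n set0 (@stable0 M).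
rewrite cards0 addn0 cardT mul2n => /(_ erefl); rewrite theta_refl //.
move=> h; apply: (mulfI (expf_neq0 n x_neq0)); rewrite [RHS]mulrC /rising -h.
by congr (_ * _); apply: eq_bigl => N; rewrite agree0 andbT.
Qed.

Lemma sum_theta_edge M p q : M \in matchings e -> e p q ->
  \sum_(N in matchings e | N p == q) theta M N =
  (if M p == q then x else eps) * rising x eps n.-1.
Proof.
move=> Min pq; have MK := matchingK Min.
have T_gt0 : (0 < #|T|)%N by apply/card_gt0P; exists p.
have n_gt0 : (0 < n)%N by move: T_gt0; rewrite cardT double_gt0.
have main : \sum_(N in matchings e | N p == M p) theta M N = x * rising x eps n.-1.
  have cardC : (2 * n.-1 + #|[set p; M p]| = #|T|)%N.
    by rewrite card_edge // cardT; lia.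
  have := @sum_matchings e e_irr e_sym e_multi F M (theta M) d x eps Min
    (fun N a => @theta_conj M N a Min) (fun C a r => @degree M C a r Min)
    n.-1 _ (stable_edge p MK) cardC.
  rewrite theta_refl // -[in x ^+ n](prednK n_gt0) exprS mulrA => h.
  apply: (mulfI (expf_neq0 n.-1 x_neq0)).
  rewrite [RHS]mulrC [x * _]mulrC /rising -h; congr (_ * _).
  apply: eq_bigl => N; case: (boolP (N \in _)) => //= Nin.
  by rewrite agree_edge //; apply: matchingK.
have [<-//|Mpq] := eqVneq; apply: (mulfI x_neq0).
(* One move at [p] reduces the partner [q] to the partner [M p], at the cost of replacing the factor
   [x] by [eps]. *)
have := @sum_matchings_move e e_irr e_sym e_multi F M (theta M) x eps Min
    (fun N a => @theta_conj M N a Min) set0 p q (@stable0 M).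
rewrite !inE eq_sym => /(_ isT isT pq Mpq).
have noC c : \sum_(N in matchings e | agree M set0 N && (N p == c)) theta M N =
    \sum_(N in matchings e | N p == c) theta M N.
  by apply: eq_bigl => N; rewrite agree0.
rewrite !noC main => ->; ring.
Qed.

Section Counting.
Variable tau : {perm T}.
Hypothesis tau_in : tau \in matchings e.

(** The constant function 1 obeys the exchange rule with [x = eps = 1], so the general summation
    counts matchings. *)
Lemma count_matchings r C : stable tau C -> (2 * r + #|C| = #|T|)%N ->
  \sum_(N in matchings e | agree tau C N) (1 : F) = rising 1 1 r.
Proof.
move=> stC cardC; have := @sum_matchings e e_irr e_sym e_multi F tau (fun=> 1) d
  1 1 tau_in (fun _ _ _ _ => erefl) (fun C a r => @degree tau C a r tau_in) r C stC cardC.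
by rewrite expr1n mul1r mulr1.
Qed.

Lemma count_edge p :
  \sum_(N in matchings e | N p == tau p) (1 : F) = rising 1 1 n.-1.
Proof.
have T_gt0 : (0 < #|T|)%N by apply/card_gt0P; exists p.
rewrite -(count_matchings (stable_edge p (matchingK tau_in))); last first.
  by move: T_gt0; rewrite card_edge // cardT double_gt0; lia.
apply: eq_bigl => N; case: (boolP (N \in _)) => //= Nin.
by rewrite agree_edge //; apply: matchingK.
Qed.

Lemma count_edge2 p p' : p' != p -> p' != tau p ->
  \sum_(N in matchings e | (N p == tau p) && (N p' == tau p')) (1 : F)
    = rising 1 1 n.-2.
Proof.
move=> pp' ptp'; have tauK := matchingK tau_in.
have cardC : #|[set p; tau p] :|: [set p'; tau p']| = 4%N.
  rewrite cardsU !card_edge // (_ : _ :&: _ = set0) ?cards0 //.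
  apply/setP => z; rewrite !inE; apply/negP => /andP[/orP[]/eqP-> /orP[]].
  - by rewrite eq_sym (negbTE pp').
  - by rewrite -(can2_eq tauK tauK) eq_sym (negbTE ptp').
  - by rewrite eq_sym (negbTE ptp').
  - by rewrite (inj_eq perm_inj) eq_sym (negbTE pp').
have T_ge4 : (4 <= #|T|)%N by rewrite -cardC max_card.
rewrite -(count_matchings (C := [set p; tau p] :|: [set p'; tau p'])).
- apply: eq_bigl => N; case: (boolP (N \in _)) => //= Nin.
  by rewrite agreeU !agree_edge //; apply: matchingK.
- exact: stableU (stable_edge _ _) (stable_edge _ _).
- by move: T_ge4; rewrite cardC cardT; lia.
Qed.

Lemma curve_form_chi : 0 <= curve_form chi -> 0 <= rising x eps n.
Proof.
rewrite /curve_form (eq_bigr (fun=> rising x eps n)); last exact: sum_theta.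
rewrite sumr_const pmulrn_lge0 //; apply/card_gt0P; exists tau; exact: tau_in.
Qed.

Variables (P : {set T}) (eta : T -> F).
Hypothesis P_tau : forall p, p \in P -> tau p \notin P.

(** The coefficient of [eta p * eta p'] sums over the [M] containing the edge of [tau] at [p] and
    the [N] containing the one at [p']. The sum over [N] yields a factor [x] or [eps], according to
    whether [M] contains the edge at [p']; [k1] and [k2] count the [M] through one and through two
    given edges. By [P_tau], distinct points of [P] lie on distinct edges. *)
Lemma curve_form_edges :
  let s1 := \sum_(p in P) eta p in
  let s2 := \sum_(p in P) eta p ^+ 2 in
  let k1 := rising 1 1 n.-1 in
  let k2 := rising 1 1 n.-2 in
  curve_form (fun N => chi N * \sum_(p in P) eta p * (N p == tau p)%:R) =
  rising x eps n.-1 *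
    (s2 * x * k1 + (s1 ^+ 2 - s2) * (x * k2 + eps * (k1 - k2))).
Proof.
move=> s1 s2 k1 k2; pose G := rising x eps n.-1.
(* The coefficient of [eta p * eta p'] without the common factor [G]. *)
pose A p p' : F := \sum_(M in matchings e | M p == tau p)
   (if M p' == tau p' then x else eps).
have AE p p' : p \in P -> p' \in P ->
    A p p' = (p' == p)%:R * (x * k1 - (x * k2 + eps * (k1 - k2)))
       + (x * k2 + eps * (k1 - k2)).
  move=> pP p'P.
  have Asplit : A p p' = eps * k1 + (x - eps) *
      \sum_(M in matchings e | (M p == tau p) && (M p' == tau p')) (1 : F).
    rewrite /k1 -(count_edge p) !mulr_sumr.
    rewrite [X in _ + X](eq_bigl (fun M => ((M \in matchings e) && (M p == tau p))
       && (M p' == tau p'))); last by move=> M; rewrite andbA.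
    rewrite [X in _ + X]big_mkcondr -big_split /=; apply: eq_bigr => M _.
    by case: eqP => _; ring.
  have [p'E|pp'] := eqVneq p' p.
    rewrite Asplit p'E (eq_bigl (fun M => (M \in matchings e) && (M p == tau p))).
      by rewrite count_edge -/k1 ?eqxx /= mul1r; ring.
    by move=> M; rewrite andbb.
  rewrite Asplit count_edge2 //.
    by rewrite -/k2 ?(negbTE pp') /= mul0r; ring.
  by apply: contraTneq p'P => ->; apply: P_tau.
have expand : curve_form (fun N => chi N * \sum_(p in P) eta p * (N p == tau p)%:R) =
    \sum_(p in P) \sum_(p' in P) eta p * eta p' * (G * A p p').
  transitivity (\sum_(M in matchings e) \sum_(p in P) \sum_(p' in P)
      eta p * eta p' * (M p == tau p)%:R *
        \sum_(N in matchings e | N p' == tau p') theta M N).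
    apply: eq_bigr => M Min.
    transitivity (\sum_(N in matchings e) \sum_(p in P) \sum_(p' in P)
       eta p * eta p' * (M p == tau p)%:R * ((N p' == tau p')%:R * theta M N)).
      apply: eq_bigr => N Nin.
      rewrite /= mulrACA big_distrlr [LHS]mulrAC mulr_sumr /=; apply: eq_bigr => p _.
      rewrite mulr_sumr; apply: eq_bigr => p' _; rewrite /theta.
      by move: (x ^+ _) => y; ring.
    rewrite exchange_big /=; apply: eq_bigr => p _.
    rewrite exchange_big /=; apply: eq_bigr => p' _.
    rewrite -mulr_sumr; congr (_ * _); rewrite big_mkcondr /=.
    by apply: eq_bigr => N _; case: eqP => _; rewrite ?mul1r ?mul0r.
  rewrite exchange_big /=; apply: eq_bigr => p _.
  rewrite exchange_big /=; apply: eq_bigr => p' _.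
  rewrite /A !mulr_sumr big_mkcondr /=; apply: eq_bigr => M Min.
  rewrite sum_theta_edge //; last by case/matchingsP: tau_in.
  by case: (M p == _); case: (M p' == _); rewrite /= -/G; ring.
rewrite expand; set B := x * k2 + _.
transitivity (\sum_(p in P) (eta p ^+ 2 * (G * (x * k1 - B)) + eta p * s1 * (G * B))).
  apply: eq_bigr => p pP.
  transitivity (\sum_(p' in P) ((p' == p)%:R * (eta p * eta p' * (G * (x * k1 - B)))
      + eta p * eta p' * (G * B))).
    by apply: eq_bigr => p' p'P; rewrite AE // -/B; ring.
  rewrite big_split /= -mulr_suml -mulr_sumr; congr (_ + _).
  rewrite (bigD1 p) //= eqxx mul1r big1 ?addr0 ?expr2 // => p' /andP[_ /negbTE->].
  by rewrite mul0r.
by rewrite big_split /= -mulr_suml -/s2 -mulr_suml -mulr_suml -/s1 -/G; ring.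
Qed.

End Counting.
End QuadraticForm.
End Matchings.

(** * Complete and complete bipartite graphs *)

Lemma degree_complete (T : finType) (C : {set T}) (a : T) r : a \notin C ->
  (2 * r.+1 + #|C| = #|T|)%N ->
  #|[pred b | a != b & b \notin C]| = (2 * r).+1.
Proof.
move=> aC cardC; have := cardsC (a |: C); rewrite cardsU1 aC -cardC.
rewrite (_ : #|~: _| = #|[pred b | a != b & b \notin C]|); first lia.
by apply: eq_card => b; rewrite !inE negb_or eq_sym.
Qed.

Lemma matchings_conj (T : finType) (e : rel T) (g N : {perm T}) :
    (forall y z, e (g y) (g z) = e y z) ->
  ((N ^ g)%g \in matchings e) = (N \in matchings e).
Proof.
move=> eg; suff imp (h s : {perm T}) : (forall y z, e (h y) (h z) = e y z) ->
    s \in matchings e -> (s ^ h)%g \in matchings e.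
  apply/idP/idP => [|Nin]; last exact: imp.
  rewrite -{2}(conjgK g N); apply: imp => y z.
  by rewrite -{2}(permKV g y) -{2}(permKV g z) eg.
move=> eh /matchingsP[sK se]; apply/matchingsP; split; first exact: conjK.
by move=> z; rewrite -(permKV h z) permJ eh.
Qed.

Section Bipartite.
Variables (T : finType) (side : T -> bool).
Definition cross (y z : T) := side y != side z.

Lemma cross_irr : irreflexive cross.
Proof. by move=> z; rewrite /cross eqxx. Qed.

Lemma cross_sym : symmetric cross.
Proof. by move=> y z; rewrite /cross eq_sym. Qed.

Lemma cross_multi a y z w : cross a y -> cross a z -> cross y w -> w != z -> cross z w.
Proof. by rewrite /cross; do 4!case: (side _). Qed.

Lemma cross_side (M : {perm T}) z : M \in matchings cross -> side (M z) = ~~ side z.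
Proof. by case/matchingsP=> _ /(_ z); rewrite /cross; do 2!case: (side _). Qed.

(** [M] exchanges the two sides of the complement of [C], so its [2 * r.+1] points are split
    evenly. *)
Lemma degree_cross (M : {perm T}) (C : {set T}) (a : T) r :
    M \in matchings cross -> stable M C -> a \notin C ->
    (2 * r.+1 + #|C| = #|T|)%N ->
  #|[pred b | cross a b & b \notin C]| = (1 * r).+1.
Proof.
move=> Min stC aC cardC; pose A := [set b | side a != side b & b \notin C].
pose B := [set b | side a == side b & b \notin C].
have BE : B = M @: A.
  have MK := matchingK Min.
  apply/setP => z; rewrite -[z in RHS]MK (mem_imset _ _ perm_inj) !inE.
  by rewrite stC cross_side //; do 2!case: (side _).
have cardB : #|B| = #|A| by rewrite BE card_imset //; apply: perm_inj.
have := cardsC C; rewrite -(cardsID [set b | side a == side b] (~: C)).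
rewrite (_ : _ :&: _ = B); last by apply/setP => z; rewrite !inE andbC.
rewrite (_ : _ :\: _ = A); last by apply/setP => z; rewrite !inE.
rewrite (_ : #|[pred b | _ & _]| = #|A|); last by apply: eq_card => z; rewrite !inE.
by rewrite cardB -cardC; lia.
Qed.

Variable J : {perm T}.
Hypothesis J_in : J \in matchings cross.

(* The bijection from the points on the side [false] to those on the side
   [true] defined by [N], turned by [J] into a permutation of the former. *)
Definition half_perm (N : {perm T}) : {perm T} :=
  restr_perm [set z | ~~ side z] (N * J)%g.

Lemma half_permE N z : N \in matchings cross ->
  half_perm N z = if side z then z else J (N z).
Proof.
move=> Nin; case: ifP => sz.
  by apply: (out_perm (restr_perm_on _ _)); rewrite inE sz.
rewrite restr_permE ?permM ?inE ?sz //.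
by apply/subsetP => y; rewrite !inE /= apermE permM !cross_side // negbK.
Qed.

(** The exchange composes the half permutation with one transposition: on the right side of the map
    if [M a] and [N a] lie on the side [false], and otherwise after it, transported by [J]. *)
Lemma odd_half_conj M N a : M \in matchings cross -> N \in matchings cross ->
  N a != M a ->
  half_perm (N ^ tperm (M a) (N a))%g = ~~ half_perm N :> bool.
Proof.
move=> Min Nin NM; set t := tperm _ _.
have Ntin : (N ^ t)%g \in matchings cross.
  apply: (matching_conj cross_irr cross_sym cross_multi Nin (a := a)) => //.
  - by case/matchingsP: Min.
  - by case/matchingsP: Nin.
  - by rewrite eq_sym.
have tid z : side z = side a -> t z = z.
  by move=> sz; apply: tpermD; apply: contra_eqN sz => /eqP<-;
    rewrite cross_side //; case: (side a).
have tside z : side (t z) = side z.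
  by rewrite /t; case: tpermP => // ->; rewrite !cross_side.
case sa: (side a).
  have -> : half_perm (N ^ t)%g = (t * half_perm N)%g.
    apply/permP => z; rewrite permM !half_permE // tside.
    case: ifP => sz; first by rewrite tid // sa sz.
    by rewrite conj_tpermE -/t (tid (N (t z))) // cross_side // tside sa sz.
  by rewrite odd_mul_tperm eq_sym NM.
have -> : half_perm (N ^ t)%g = (half_perm N * t ^ J)%g.
  apply/permP => z; rewrite permM !half_permE //.
  have JK := matchingK J_in.
  case: ifP => sz; last by rewrite permJ conj_tpermE -/t (tid z) ?sz.
  by rewrite -{2}(JK z) permJ tid ?JK // cross_side // sz sa.
by rewrite odd_permM odd_permJ /t odd_tperm eq_sym NM addbT.
Qed.

(** Such a [g] conjugates the half permutation, and conjugation preserves parity. *)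
Lemma odd_half_J (g N : {perm T}) : N \in matchings cross ->
    (forall z, side (g z) = side z) -> (forall z, J (g z) = g (J z)) ->
  half_perm (N ^ g)%g = half_perm N :> bool.
Proof.
move=> Nin gs gJ; rewrite -(odd_permJ (half_perm N) g); congr odd_perm.
apply/permP => z; rewrite -(permKV g z); set y := (g^-1)%g z.
have Ngin : (N ^ g)%g \in matchings cross.
  by rewrite matchings_conj // => ? ?; rewrite /cross !gs.
by rewrite permJ !half_permE // gs permJ gJ; case: ifP.
Qed.

End Bipartite.

(** * Curves of a union of two matchings *)

Section Components.
Variables (T : finType) (M N : {perm T}).
Hypotheses (MK : involutive M) (NK : involutive N).
Hypotheses (M_neq : forall z, M z != z) (N_neq : forall z, N z != z).
Let s : {perm T} := (N * M)%g.

(** [M] and [N] generate a dihedral group, in which conjugation by [M] inverts [s]. *)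
Lemma invol_expg i z : M ((s ^+ i)%g z) = (s ^- i)%g (M z).
Proof.
have Ms y : M (s y) = (s^-1)%g (M y).
  by apply: (@perm_inj _ s); rewrite permKV !permM !MK NK.
elim: i z => [|i IHi] z; first by rewrite expg0 invg1 !perm1.
by rewrite [in LHS](expgS s i) permM IHi Ms (expgSr s i) (invMg (s ^+ i)%g s) permM.
Qed.

Lemma mem_porbit_invol y z : y \in porbit s z -> M y \in porbit s (M z).
Proof.
by case/porbitP=> i ->; rewrite invol_expg -porbitV -(expVgn s i) mem_porbit.
Qed.

Lemma invol_notin_porbit z : M z \notin porbit s z.
Proof.
apply/negP => /porbitP[i Mz].
(* Folding the path from [z] to [M z] at its middle gives a fixed point of [M] if [i] is even and
   one of [N] if [i] is odd. *)
have fold j m : i = (j + m)%N -> M ((s ^+ j)%g z) = (s ^+ m)%g z.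
  move=> iE; by rewrite invol_expg Mz iE addnC (expgnDr s m j) permM permK.
have := odd_double_half i; set j := i./2; rewrite -addnn.
case: (odd i) => /= iE; last first.
  by have /eqP := fold j j (esym iE); apply/negP.
have := fold j j.+1; rewrite -iE addnS => /(_ erefl).
rewrite (expgSr s j) permM [RHS]permM => /perm_inj/esym/eqP; apply/negP; exact: N_neq.
Qed.

Definition component z := porbit s z :|: porbit s (M z).

Lemma component_id z : z \in component z.
Proof. by rewrite inE porbit_id. Qed.

Lemma componentM y z : (M y \in component z) = (y \in component z).
Proof.
suff imp w : w \in component z -> M w \in component z.
  by apply/idP/idP => /imp //; rewrite MK.
by rewrite !inE => /orP[]/mem_porbit_invol; rewrite ?MK => ->; rewrite ?orbT.
Qed.

Lemma component_step y z : (s y \in component z) = (y \in component z).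
Proof.
have E : porbit s (s y) = porbit s y.
  by apply/eqP; rewrite eq_porbit_mem; apply: (mem_porbit s 1).
rewrite /component !in_setU -(eq_porbit_mem s (s y)) -(eq_porbit_mem s (s y)) E.
by rewrite !eq_porbit_mem.
Qed.

Lemma componentN y z : (N y \in component z) = (y \in component z).
Proof. by rewrite -componentM -permM component_step. Qed.

(** A component consists of the orbits of [z] and [M z], which are distinct; hence the halving in
    [curves] is exact. *)
Lemma card_components : (#|[set component z | z : T]|.*2 = #|porbits s|)%N.
Proof.
pose Phi (O : {set T}) := O :|: M @: O.
have PhiE z : Phi (porbit s z) = component z.
  rewrite /Phi /component; congr (_ :|: _); apply/setP => y.
  rewrite -[y in LHS]MK (mem_imset _ _ perm_inj); apply/idP/idP => /mem_porbit_invol.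
    by rewrite MK.
  by rewrite MK.
rewrite -[RHS]sum1_card (partition_big Phi [in [set component z | z : T]]) /=; last first.
  by move=> _ /imsetP[z _ ->]; rewrite PhiE imset_f.
rewrite -muln2 -sum_nat_const; apply: eq_bigr => _ /imsetP[z _ ->].
have zMz : porbit s z != porbit s (M z).
  by rewrite eq_sym eq_porbit_mem invol_notin_porbit.
rewrite sum1_card -(_ : #|[set porbit s z; porbit s (M z)]| = 2%N); last first.
  by rewrite cards2 zMz.
apply: eq_card => O; rewrite !inE unfold_in.
apply/idP/andP => [/orP[]/eqP->|[/imsetP[y _ ->]]].
- by rewrite imset_f // PhiE.
- by rewrite imset_f // PhiE /component MK setUC.
rewrite PhiE => /eqP/setP/(_ y); rewrite component_id => /esym.
by rewrite inE -!eq_porbit_mem.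
Qed.

End Components.

(** * Classes of two sheets glued along a permutation *)

Section TwoSheets.
Variables (T T' : finType) (M N g : {perm T}).
Hypotheses (MK : involutive M) (NK : involutive N).
Hypotheses (M_neq : forall z, M z != z) (N_neq : forall z, N z != z).
Variables (adj : rel T') (l r : T -> T').
Hypothesis l_inj : injective l.
Hypothesis r_inj : injective r.
Hypothesis l_neq_r : forall y z, l y != r z.
Hypothesis cover : forall w, (exists y, w = l y) \/ (exists y, w = r y).
Hypothesis adj_sym : symmetric adj.
Hypothesis adj_l : forall y w, adj (l y) w = (w == l (M y)) || (w == r (g y)).
Hypothesis adj_r : forall y w, adj (r y) w = (w == r (N y)) || (w == l ((g^-1)%g y)).

(** The sheets [l] and [r] carry the edges of [M] and [N]. Pulling the right sheet back along [g]
    turns [N] into [N'], and a class is determined by its trace on the left sheet, which is a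
    component of [M] and [N']. *)
Lemma card_connect_classes :
  #|[set [set w | connect adj w0 w] | w0 : T']| = curves M (N ^ (g^-1))%g.
Proof.
set N' := (N ^ _)%g; pose K w0 := [set w | connect adj w0 w].
have N'K : involutive N' by exact: conjK.
have N'_neq z : N' z != z.
  rewrite -(permKV (g^-1)%g z) /N' permJ (inj_eq perm_inj); exact: N_neq.
have csym : connect_sym adj by apply: sym_connect_sym.
have NE y : N (g y) = g (N' y).
  by apply: (@perm_inj _ (g^-1)%g); rewrite permK -permJ permK.
have KE w w0 : w \in K w0 -> K w = K w0.
  by rewrite inE => h; apply/setP => w1; rewrite !inE (same_connect csym h).
have lM y : connect adj (l y) (l (M y)) by rewrite connect1 ?adj_l ?eqxx.
have lr y : connect adj (l y) (r (g y)) by rewrite connect1 ?adj_l ?eqxx ?orbT.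
have lN y : connect adj (l y) (l (N' y)).
  apply: (connect_trans (lr y)); rewrite csym; apply: (connect_trans (lr _)).
  by rewrite -NE connect1 // adj_r NK eqxx.
pose comp := component M N'.
have compP y z : (l y \in K (l z)) = (y \in comp z).
  rewrite inE; apply/idP/idP.
    (* The component of [z] on the left sheet and its image on the right one: a set closed under
       [adj], hence containing the class of [l z]. *)
    pose Z := [pred w | [exists y, ((w == l y) || (w == r (g y))) && (y \in comp z)]].
    have Zl y1 : (l y1 \in Z) = (y1 \in comp z).
      apply/existsP/idP => [[y2 /andP[]]|yz]; last by exists y1; rewrite eqxx.
      by rewrite (negbTE (l_neq_r _ _)) orbF (inj_eq l_inj) => /eqP->.
    have Zr y1 : (r (g y1) \in Z) = (y1 \in comp z).
      apply/existsP/idP => [[y2 /andP[]]|yz]; last by exists y1; rewrite eqxx orbT.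
      by rewrite eq_sym (negbTE (l_neq_r _ _)) (inj_eq r_inj) (inj_eq perm_inj) => /eqP->.
    have Zcl : closed adj Z.
      move=> w w'; case: (cover w) => -[y1 ->].
        rewrite adj_l => /orP[]/eqP->; rewrite ?Zl ?Zr //.
        by rewrite /comp componentM.
      rewrite -(permKV g y1) adj_r => /orP[]/eqP->; rewrite ?NE ?permK ?Zl ?Zr //.
      by rewrite /comp componentN.
    by move/(closed_connect Zcl); rewrite !Zl /comp component_id => <-.
  have sub y1 y2 : y1 \in porbit (N' * M)%g y2 -> connect adj (l y2) (l y1).
    case/porbitP=> i ->; elim: i => [|i IHi]; first by rewrite expg0 perm1.
    apply: (connect_trans IHi); rewrite (expgSr (N' * M)%g i) permM [(N' * M)%g _]permM.
    exact: connect_trans (lN _) (lM _).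
  rewrite inE => /orP[/sub//|/sub]; exact: connect_trans.
rewrite /curves -card_components // doubleK.
have -> : [set K w0 | w0 : T'] = [set K (l z) | z : T].
  apply/setP => A; apply/imsetP/imsetP => -[w _ ->]; last by exists (l w).
  case: (cover w) => -[y ->]; first by exists y.
  by exists ((g^-1)%g y) => //; apply: KE; rewrite inE -{2}(permKV g y) lr.
have -> : [set component M N' z | z : T] =
    [set l @^-1: A | A : {set T'} in [set K (l z) | z : T]].
  rewrite -imset_comp; apply: eq_imset => z; apply/setP => y.
  by rewrite -/(comp z) -compP !inE.
rewrite card_in_imset // => _ _ /imsetP[y _ ->] /imsetP[z _ ->] /setP/(_ y).
rewrite !inE connect0 => /esym yz; apply: KE; by rewrite inE.
Qed.
End TwoSheets.

(** * Joins of diagrams without free loops *)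

Section Evaluation.
Variables (R : realType) (f : diagram -> R).
Hypothesis f_iso : isomorphism_invariant f.
Hypothesis f_mult : multiplicative_on_diagrams f.

Lemma isomorphic_free_loops (D : diagram) : (crossing D -> False) ->
  isomorphic D (free_loops (loops D)).
Proof.
move=> noD; exists (fun z => match noD z with end), (fun=> false).
split=> //; last by case=> c; case: (noD c).
by exists (of_void _) => [c|[]]; case: (noD c).
Qed.

Lemma eval_free_loops t : f (free_loops t) = f circle ^+ t.
Proof.
elim: t => [|t IHt]; first exact: (proj1 f_mult).
rewrite exprSr -IHt -(proj2 f_mult).
have -> : free_loops t.+1 = free_loops (loops (disjoint_union (free_loops t) circle)).
  by rewrite /= addn1.
by apply/esym/f_iso/isomorphic_free_loops; case.
Qed.

Lemma eval_no_crossing (D : diagram) : (crossing D -> False) ->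
  f D = f circle ^+ loops D.
Proof. by move=> noD; rewrite (f_iso (isomorphic_free_loops noD)) eval_free_loops. Qed.

End Evaluation.

Definition distinct (T : eqType) (y z : T) := y != z.

Lemma injections_inj k (T : finType) (w : injections k T) : injective (val w).
Proof. by apply/injectiveP; case: w. Qed.
Arguments injections_inj {k T} w [x1 x2] _.

Section Joins.
Variable k : nat.
Local Notation point := ('I_k * 'Z_4)%type.

(** Permutations of the crossings combined with the renumberings allowed at each crossing. *)
Definition block_perm (g : {perm point}) : Prop :=
  exists (p : {perm 'I_k}) (q : 'I_k -> bool),
    forall y, g y = (p y.1, turn (q y.1) y.2).

Section JoinPerm.
Variables (u v : injections k 'I_k) (s : {ffun 'I_k -> bool}).
Let pu := perm (injections_inj u).
Let pv := perm (injections_inj v).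

(** Injective [k]-tuples of [k] crossings are permutations, so the gluing is defined on all
    half-edges of the left diagram. *)
Definition join_fun (y : point) : point :=
  ((pu^-1 * pv)%g y.1, turn (s ((pu^-1)%g y.1)) y.2).

Lemma join_fun_inj : injective join_fun.
Proof.
by case=> [c j] [c' j'] [/= /perm_inj-> /(can_inj (turnK _)) ->].
Qed.

Definition join_perm : {perm point} := perm join_fun_inj.

Lemma join_permE i j : join_perm (val u i, j) = (val v i, turn (s i) j).
Proof.
have uK : (pu^-1)%g (val u i) = i.
  by apply: (@perm_inj _ pu); rewrite permKV permE.
by rewrite permE /join_fun /= permM uK permE.
Qed.

Lemma join_perm_block : block_perm join_perm.
Proof. by exists (pu^-1 * pv)%g, (s \o (pu^-1)%g) => y; rewrite permE. Qed.

End JoinPerm.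

Definition matching_type := {N : {perm point} | N \in matchings (@distinct point)}.

Lemma matching_typeK (N : matching_type) : involutive (val N).
Proof. by case/matchingsP: (valP N). Qed.

Lemma matching_type_neq (N : matching_type) z : val N z != z.
Proof. by case/matchingsP: (valP N) => _ /(_ z); rewrite eq_sym. Qed.

Definition matching_diagram (N : matching_type) : diagram :=
  Diagram 0 (@matching_typeK N) (@matching_type_neq N).

(** All crossings are deleted, so every class is a closed curve, and the count for two sheets
    applies. *)
Lemma closed_curves_join (M N : matching_type)
    (u : injections k (matching_diagram M)) (v : injections k (matching_diagram N)) s :
  closed_curves (join_del u v) (join_glue u v s) =
    curves (val M) (val N ^ (join_perm u v s)^-1)%g.
Proof.
pose l (y : point) : halfedge (disjoint_union (matching_diagram M) (matching_diagram N))
  := (inl y.1, y.2).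
pose r (y : point) : halfedge (disjoint_union (matching_diagram M) (matching_diagram N))
  := (inr y.1, y.2).
have perm_onto (w : injections k 'I_k) c : exists i, c = val w i.
  pose pw := perm (injections_inj w).
  by exists ((pw^-1)%g c); rewrite -[LHS](permKV pw) permE.
have no_surv (y : halfedge (disjoint_union (matching_diagram M) (matching_diagram N))) :
    ~~ surviving (join_del u v) y.
  rewrite /surviving negbK !inE; case: y => -[] c j /=.
    by have [i ->] := perm_onto u c; rewrite imset_f.
  by have [i ->] := perm_onto v c; rewrite imset_f ?orbT.
have glue_l y : join_glue u v s (l y) = r (join_perm u v s y).
  case: y => c j; have [i ->] := perm_onto u c.
  by rewrite /r join_permE /= (pick_u u).
have glue_r y : join_glue u v s (r y) = l ((join_perm u v s)^-1 y)%g.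
  by rewrite -{1}(permKV (join_perm u v s) y) -glue_l join_glueK.
rewrite -(@card_connect_classes _ _ _ _ (join_perm u v s) (@matching_typeK M)
  (@matching_typeK N) (@matching_type_neq M) (@matching_type_neq N)
  (adjacent (join_glue u v s)) l r).
- rewrite /closed_curves; congr #|pred_of_set _|.
  apply/setP => A; apply/imsetP/imsetP => -[w _ ->]; exists w => //.
  by rewrite inE; apply/forallP => y; rewrite no_surv implybT.
- by case=> [c j] [c' j'] [-> ->].
- by case=> [c j] [c' j'] [-> ->].
- by [].
- by case=> -[] c j; [left | right]; exists (c, j).
- move=> w w'; rewrite /adjacent /=; congr (_ || _).
    by apply/eqP/eqP => ->; rewrite union_mateK.
  by apply/eqP/eqP => ->; rewrite join_glueK.
- by move=> y w; rewrite -glue_l; case: y.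
- by move=> y w; rewrite -glue_r; case: y.
Qed.

Variables (R : realType) (f : diagram -> R).
Hypothesis f_iso : isomorphism_invariant f.
Hypothesis f_mult : multiplicative_on_diagrams f.
Hypothesis f_wrp : weakly_reflection_positive f.

Lemma eval_kjoin (M N : matching_type) :
  linear_ext f (kjoin R k (matching_diagram M) (matching_diagram N)) =
  \sum_(z : injections k 'I_k * injections k 'I_k * {ffun 'I_k -> bool})
    2^-1 ^+ k * f circle ^+ curves (val M) (val N ^ (join_perm z.1.1 z.1.2 z.2)^-1)%g.
Proof.
rewrite /linear_ext /kjoin big_image /=; apply: eq_bigr => -[[u v] s] _ /=.
rewrite (eval_no_crossing f_iso f_mult).
  by rewrite /= closed_curves_join.
case=> -[c|c] /negP[]; rewrite !inE.
  pose pw := perm (injections_inj u).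
  by rewrite -[c](permKV pw) permE imset_f.
pose pw := perm (injections_inj v).
by rewrite -[c](permKV pw) permE imset_f ?orbT.
Qed.

Lemma psd_finType (T : Type) (A : T -> T -> R) (I : finType) (D : I -> T) (c : I -> R) :
  positive_semidefinite A -> 0 <= \sum_i \sum_j c i * A (D i) (D j) * c j.
Proof.
move=> [_ /(_ #|I| (D \o enum_val) (c \o enum_val))].
congr (_ <= _); rewrite [RHS](reindex _ (onW_bij _ (@enum_val_bij I))).
by apply: eq_bigr => i _; rewrite [RHS](reindex _ (onW_bij _ (@enum_val_bij I))).
Qed.

(** Take [w] as test vector on the matching diagrams. Each term of the join replaces [N] by its
    conjugate under a block permutation; reindexing undoes this because [w] is invariant, so all
    terms give the same form. *)
Lemma curve_form_ge0 (w : {perm point} -> R) :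
    (forall g N, block_perm g -> N \in matchings (@distinct point) ->
       w (N ^ g)%g = w N) ->
  0 <= curve_form (@distinct point) (f circle) w.
Proof.
move=> w_block; set x := f circle.
have distinctJ (g : {perm point}) y z : distinct (g y) (g z) = distinct y z.
  by rewrite /distinct (inj_eq perm_inj).
have := psd_finType matching_diagram (w \o val) (f_wrp k).
set Q := \sum_i _ => Q_ge0.
pose Z := (injections k 'I_k * injections k 'I_k * {ffun 'I_k -> bool})%type.
have QE : Q = \sum_(z : Z) 2^-1 ^+ k * curve_form (@distinct point) x w.
  transitivity (\sum_(z : Z) 2^-1 ^+ k *
     \sum_(M : matching_type) \sum_(N : matching_type) w (val M) * w (val N) *
       x ^+ curves (val M) (val N ^ (join_perm z.1.1 z.1.2 z.2)^-1)%g).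
    rewrite /Q.
    under [RHS]eq_bigr => z _ do rewrite mulr_sumr.
    rewrite [RHS]exchange_big; apply: eq_bigr => M _ /=.
    under [RHS]eq_bigr => z _ do rewrite mulr_sumr.
    rewrite [RHS]exchange_big; apply: eq_bigr => N _ /=.
    rewrite eval_kjoin mulr_sumr mulr_suml; apply: eq_bigr => z _.
    by rewrite -/x; move: (x ^+ _) (_ ^+ k) => a b; ring.
  apply: eq_bigr => z _; congr (_ * _); rewrite /curve_form.
  rewrite [RHS]big_sub; apply: eq_bigr => M _.
  set g := join_perm _ _ _.
  transitivity (\sum_(N in matchings (@distinct point))
     w (val M) * w N * x ^+ curves (val M) (N ^ g^-1)%g); first by rewrite [RHS]big_sub.
  rewrite [RHS](reindex_inj (@conjg_inj _ (g^-1)%g)) /=.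
  apply: eq_big => [N|N Nin]; first by rewrite matchings_conj.
  congr (_ * _ * _); rewrite -[N in LHS](conjgKV g).
  apply: w_block; first exact: join_perm_block.
  by rewrite matchings_conj.
move: Q_ge0; rewrite QE sumr_const pmulrn_lge0; last first.
  (* The identity tuples show that there is at least one term. *)
  have id_inj : injectiveb [ffun i : 'I_k => i].
    by apply/injectiveP => i j; rewrite !ffunE.
  pose id_k : injections k 'I_k := exist (fun w : {ffun 'I_k -> 'I_k} => injectiveb w) _ id_inj.
  by apply/card_gt0P; exists (id_k, id_k, [ffun=> false]).
by rewrite pmulr_rge0 // exprn_gt0 // invr_gt0 ltr0n.
Qed.

End Joins.

(** * Invariant weights *)

(** Both ends of an edge of [tau] contribute equally, so the sum over [P] is half of the sum over
    all points. The latter can be reindexed by [g], which may not preserve [P]. *)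
Lemma edge_weight_conj (R : realFieldType) (T : finType) (tau g N : {perm T})
    (P : {set T}) (eta : T -> R) :
    involutive tau -> involutive N ->
    (forall p, (tau p \in P) = (p \notin P)) ->
    (forall p, eta (tau p) = eta p) -> (forall p, eta (g p) = eta p) ->
    (forall p, tau (g p) = g (tau p)) ->
  \sum_(p in P) eta p * ((N ^ g)%g p == tau p)%:R =
  \sum_(p in P) eta p * (N p == tau p)%:R.
Proof.
move=> tauK NK P_tau eta_tau eta_g tau_g.
have full (M : {perm T}) : involutive M ->
    \sum_p eta p * (M p == tau p)%:R =
    2 * \sum_(p in P) eta p * (M p == tau p)%:R.
  move=> MK; rewrite (bigID (mem P)) mulr_natl mulr2n /=; congr (_ + _).
  rewrite (reindex_inj (@perm_inj _ tau)) /=; apply: eq_big => p.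
    by rewrite P_tau negbK.
  by move=> _; rewrite eta_tau tauK (can2_eq MK MK) eq_sym.
have two_neq0 : (2 : R) != 0 by rewrite pnatr_eq0.
apply: (mulfI two_neq0).
rewrite -!full //; last exact: conjK.
rewrite (reindex_inj (@perm_inj _ g)); apply: eq_bigr => p _.
by rewrite permJ tau_g (inj_eq perm_inj) eta_g.
Qed.

Lemma card_half (T : finType) (tau : {perm T}) (P : {set T}) n :
  (forall p, (tau p \in P) = (p \notin P)) -> #|T| = n.*2 -> #|P| = n.
Proof.
move=> P_tau cardT; have := cardsC P.
have -> : #|~: P| = #|P|.
  rewrite -(card_imset _ (@perm_inj _ tau)) -[in RHS](setCK P) /=.
  apply: eq_card => p; rewrite -(permKV tau p) (mem_imset _ _ perm_inj).
  by rewrite !inE P_tau negbK.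
by rewrite cardT addnn => /double_inj.
Qed.

Lemma rising11_gt0 (R : realFieldType) d r : 0 < rising d (1 : R) 1 r.
Proof. by apply: prodr_gt0 => i _; rewrite mul1r ltr_wpDr ?ler0n ?ltr01. Qed.

(** * The half-edges of [k] crossings and the four inequalities *)

Section HalfEdges.
Variable k : nat.
Local Notation point := ('I_k * 'Z_4)%type.

Definition opposite_fun (y : point) : point := (y.1, y.2 + 2).
(** Pairs 0 with 1 and 2 with 3, so an over-end with an under-end, compatibly with half-turns. *)
Definition neighbour_fun (y : point) : point :=
  (y.1, if odd y.2 then y.2 - 1 else y.2 + 1).

Lemma opposite_funK : involutive opposite_fun.
Proof.
by case=> v j; congr pair; apply/val_inj; case: j => -[|[|[|[|]]]].
Qed.

Lemma neighbour_funK : involutive neighbour_fun.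
Proof.
by case=> v j; congr pair; apply/val_inj; case: j => -[|[|[|[|]]]].
Qed.

Definition opposite : {perm point} := perm (inv_inj opposite_funK).
Definition neighbour : {perm point} := perm (inv_inj neighbour_funK).

Definition odd_end (y : point) : bool := odd y.2.
(** One end of each edge of [opposite]; likewise [even_ends], the set of over-ends, for
    [neighbour]. *)
Definition low_ends : {set point} := [set y : point | (y.2 < 2)%N].
Definition even_ends : {set point} := [set y : point | ~~ odd_end y].

Lemma oppositeK : involutive opposite.
Proof. by move=> y; rewrite !permE opposite_funK. Qed.

Lemma neighbourK : involutive neighbour.
Proof. by move=> y; rewrite !permE neighbour_funK. Qed.

Lemma odd_end_opposite y : odd_end (opposite y) = odd_end y.
Proof. by rewrite permE; case: y => v; case=> -[|[|[|[|]]]]. Qed.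

Lemma odd_end_neighbour y : odd_end (neighbour y) = ~~ odd_end y.
Proof. by rewrite permE; case: y => v; case=> -[|[|[|[|]]]]. Qed.

Lemma low_ends_opposite y : (opposite y \in low_ends) = (y \notin low_ends).
Proof. by rewrite !inE permE; case: y => v; case=> -[|[|[|[|]]]]. Qed.

Lemma low_ends_neighbour y : (neighbour y \in low_ends) = (y \in low_ends).
Proof. by rewrite !inE permE; case: y => v; case=> -[|[|[|[|]]]]. Qed.

Lemma even_ends_neighbour y : (neighbour y \in even_ends) = (y \notin even_ends).
Proof. by rewrite !inE odd_end_neighbour. Qed.

Lemma odd_end_block g y : block_perm g -> odd_end (g y) = odd_end y.
Proof.
by case=> p [q gE]; rewrite gE /odd_end /=; case: (q _) => //=;
  case: y => v; case=> -[|[|[|[|]]]].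
Qed.

Lemma opposite_block g y : block_perm g -> opposite (g y) = g (opposite y).
Proof.
case=> p [q gE]; rewrite !permE !gE /opposite_fun /=; congr pair.
by case: (q _) => //=; rewrite addrAC.
Qed.

Lemma neighbour_block g y : block_perm g -> neighbour (g y) = g (neighbour y).
Proof.
case=> p [q gE]; rewrite !permE !gE /neighbour_fun /=; congr pair.
by case: (q _) => //=; apply/val_inj; case: y => v; case=> -[|[|[|[|]]]].
Qed.

Lemma opposite_matching : opposite \in matchings (@distinct point).
Proof.
apply/matchingsP; split=> [|y]; first exact: oppositeK.
apply/eqP => yE; have := low_ends_opposite y; rewrite -yE.
by case: (_ \in _).
Qed.

Lemma neighbour_matching : neighbour \in matchings (cross odd_end).
Proof.
apply/matchingsP; split=> [|y]; first exact: neighbourK.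
by rewrite /cross odd_end_neighbour; case: (odd_end y).
Qed.

Lemma card_point : #|{: point}| = k.*2.*2.
Proof. by rewrite card_prod card_ord card_ord -!muln2 -mulnA. Qed.

Variables (R : realType) (f : diagram -> R).
Hypothesis f_iso : isomorphism_invariant f.
Hypothesis f_mult : multiplicative_on_diagrams f.
Hypothesis f_wrp : weakly_reflection_positive f.
Hypothesis x_neq0 : f circle != 0.

Let x := f circle.
Let n := k.*2.

Lemma distinct_irr : irreflexive (@distinct point).
Proof. by move=> y; rewrite /distinct eqxx. Qed.

Lemma distinct_sym : symmetric (@distinct point).
Proof. by move=> y z; rewrite /distinct eq_sym. Qed.

Lemma distinct_multi (a y z w : point) : distinct a y -> distinct a z ->
  distinct y w -> w != z -> distinct z w.
Proof. by rewrite /distinct [w == z]eq_sym. Qed.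

Lemma even_rising_ge0 : 0 <= rising 2 x 1 n.
Proof.
apply: (@curve_form_chi _ _ distinct_irr distinct_sym distinct_multi _ n 2 x 1
  (fun=> 1) card_point (fun M C a r _ _ => @degree_complete _ C a r)
  x_neq0 (mulr1 1) (fun _ _ => mulr1 1) (fun _ _ _ _ _ _ => esym (mulr1 1))
  opposite opposite_matching).
exact: curve_form_ge0.
Qed.

(** The signs [eta] sum to 0 over [low_ends], since [neighbour] reverses them. The form becomes
    [F_(n-1)] times [n (k1 - k2) (x - 1)], where [k1 - k2 > 0] because [1 < k]. *)
Lemma even_rising_pred_ge0 : (1 < k)%N -> 0 <= rising 2 x 1 n.-1 * (x - 1).
Proof.
move=> k_gt1; pose eta (p : point) : R := (-1) ^+ odd_end p.
have := @curve_form_edges _ _ distinct_irr distinct_sym distinct_multi _ n 2 x 1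
  (fun=> 1) card_point (fun M C a r _ _ => @degree_complete _ C a r)
  x_neq0 (mulr1 1) (fun _ _ => mulr1 1) (fun _ _ _ _ _ _ => esym (mulr1 1))
  opposite opposite_matching low_ends eta.
move=> /(_ _)/=.
set w := fun N : {perm point} => _.
have -> : \sum_(p in low_ends) eta p = 0.
  have eta_sum : \sum_(p in low_ends) eta p = - \sum_(p in low_ends) eta p.
    rewrite {1}(reindex_inj (@perm_inj _ neighbour)) -sumrN.
    apply: eq_big => p; first by rewrite low_ends_neighbour.
    by rewrite /eta odd_end_neighbour signrN.
  by lra.
have -> : \sum_(p in low_ends) eta p ^+ 2 = n%:R.
  under eq_bigr => p _ do rewrite sqrr_sign.
  by rewrite sumr_const (card_half low_ends_opposite card_point).
set k1 := rising 2 1 1 n.-1; set k2 := rising 2 1 1 n.-2.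
move=> QE.
have : 0 <= curve_form (@distinct point) x w.
  apply: curve_form_ge0 => // g N g_block Nin; rewrite /w; congr (_ * _).
  apply: edge_weight_conj.
  - exact: oppositeK.
  - exact: matchingK Nin.
  - exact: low_ends_opposite.
  - by move=> p; rewrite /eta odd_end_opposite.
  - by move=> p; rewrite /eta odd_end_block.
  - by move=> p; apply: opposite_block.
rewrite QE; last by move=> p; rewrite low_ends_opposite negbK.
have nE : n.-1 = n.-2.+1 by rewrite /n; lia.
have k2_gt0 : 0 < k2 by exact: rising11_gt0.
have k12 : k1 - k2 = k2 * (2 * n.-2)%:R.
  by rewrite /k1 nE /rising big_ord_recr /= -/(rising 2 1 1 n.-2) -/k2; ring.
have -> : n%:R * x * k1 + (0 ^+ 2 - n%:R) * (x * k2 + 1 * (k1 - k2)) =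
    n%:R * (k1 - k2) * (x - 1) by ring.
rewrite k12 mulrCA pmulr_rge0 // !mulr_gt0 // ltr0n /n; lia.
Qed.

(** Extended by zero to all matchings, [w] stays invariant, because block permutations preserve
    over-ends and under-ends. *)
Lemma cross_form_ge0 (w : {perm point} -> R) :
    (forall g N, block_perm g -> N \in matchings (cross odd_end) ->
       w (N ^ g)%g = w N) ->
  0 <= curve_form (cross odd_end) x w.
Proof.
move=> w_block.
pose w' N := if N \in matchings (cross odd_end) then w N else 0.
have crossJ (g : {perm point}) : block_perm g ->
    forall y z, cross odd_end (g y) (g z) = cross odd_end y z.
  by move=> gb y z; rewrite /cross !odd_end_block.
have := @curve_form_ge0 k R f f_iso f_mult f_wrp w'.
have -> : curve_form (@distinct point) (f circle) w' = curve_form (cross odd_end) x w.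
  have sub N : N \in matchings (cross odd_end) -> N \in matchings (@distinct point).
    move=> /matchingsP[NK Nc]; apply/matchingsP; split=> // y.
    by apply: contraTneq (Nc y) => <-; rewrite /cross eqxx.
  have restrict (G : {perm point} -> R) :
      (forall N, N \notin matchings (cross odd_end) -> G N = 0) ->
      \sum_(N in matchings (@distinct point)) G N =
      \sum_(N in matchings (cross odd_end)) G N.
    move=> G0; rewrite (bigID (mem (matchings (cross odd_end)))) /=.
    rewrite [X in _ + X]big1 ?addr0 => [|N /andP[_ /G0//]].
    by apply: eq_bigl => N; case: (boolP (N \in matchings (cross _))) => [/sub->|];
      rewrite ?andbF.
  rewrite /curve_form restrict => [|M /negbTE Mn]; last first.
    by rewrite big1 // => N _; rewrite /w' Mn !mul0r.
  apply: eq_bigr => M Min; rewrite restrict => [|N /negbTE Nn]; last first.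
    by rewrite /w' Nn mulr0 mul0r.
  by apply: eq_bigr => N Nin; rewrite /w' Min Nin.
apply=> g N gb _; rewrite /w' matchings_conj; last exact: crossJ.
by case: ifP => // Nin; apply: w_block.
Qed.

(** The sign of [N] as a permutation of the over-ends, [neighbour] identifying under-ends with
    over-ends. *)
Let chi (N : {perm point}) : R := (-1) ^+ half_perm odd_end neighbour N.

Lemma chi_sq N : chi N * chi N = 1.
Proof. by rewrite -expr2 sqrr_sign. Qed.

Lemma chi_conj M N a : M \in matchings (cross odd_end) ->
    N \in matchings (cross odd_end) -> N a != M a ->
  chi (N ^ tperm (M a) (N a))%g = -1 * chi N.
Proof.
move=> Min Nin NM; rewrite /chi (odd_half_conj neighbour_matching) // signrN.
by rewrite mulN1r.
Qed.

Lemma chi_block g N : block_perm g -> N \in matchings (cross odd_end) ->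
  chi (N ^ g)%g = chi N.
Proof.
move=> gb Nin; rewrite /chi (odd_half_J neighbour_matching) // => y.
  exact: odd_end_block.
exact: neighbour_block.
Qed.

Lemma falling_ge0 : 0 <= rising 1 x (-1) n.
Proof.
apply: (@curve_form_chi _ _ (cross_irr odd_end) (cross_sym odd_end)
  (@cross_multi _ odd_end) _ n 1 x (-1)
  chi card_point (@degree_cross _ odd_end)
  x_neq0 _ (fun N _ => chi_sq N) chi_conj
  neighbour neighbour_matching).
  by rewrite mulrNN mulr1.
exact/cross_form_ge0/chi_block.
Qed.

(** With [eta = 1] the edge sum counts the edges shared with [neighbour], which are the fixed points
    of the half permutation. *)
Lemma falling_pred_ge0 : (0 < k)%N ->
  0 <= rising 1 x (-1) n.-1 * (2 * x - n%:R + 2).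
Proof.
move=> k_gt0; pose eta (p : point) : R := 1.
have eps_sq : (-1) * (-1) = 1 :> R by rewrite mulrNN mulr1.
have := @curve_form_edges _ _ (cross_irr odd_end) (cross_sym odd_end)
  (@cross_multi _ odd_end) _ n 1 x (-1)
  chi card_point (@degree_cross _ odd_end)
  x_neq0 eps_sq (fun N _ => chi_sq N) chi_conj
  neighbour neighbour_matching even_ends eta.
move=> /(_ _)/=.
set w := fun N : {perm point} => _.
have -> : \sum_(p in even_ends) eta p = n%:R.
  by rewrite sumr_const (card_half even_ends_neighbour card_point).
have -> : \sum_(p in even_ends) eta p ^+ 2 = n%:R.
  under eq_bigr => p _ do rewrite expr1n.
  by rewrite sumr_const (card_half even_ends_neighbour card_point).
set k1 := rising 1 1 1 n.-1; set k2 := rising 1 1 1 n.-2.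
move=> QE.
have : 0 <= curve_form (cross odd_end) x w.
  apply: cross_form_ge0 => // g N g_block Nin; rewrite /w chi_block //; congr (_ * _).
  apply: edge_weight_conj => //.
  - exact: neighbourK.
  - exact: matchingK Nin.
  - exact: even_ends_neighbour.
  - by move=> p; apply: neighbour_block.
rewrite QE; last by move=> p; rewrite even_ends_neighbour negbK.
have [m nE] : exists m, n = m.+2 by exists n.-2; rewrite /n; lia.
have k2_gt0 : 0 < k2 by exact: rising11_gt0.
have k1E : k1 = k2 * m.+1%:R.
  by rewrite /k1 nE /rising big_ord_recr /= -/(rising 1 1 1 m) /k2 nE /=; ring.
have -> : n%:R * x * k1 + (n%:R ^+ 2 - n%:R) * (x * k2 + -1 * (k1 - k2)) =
    n%:R * k2 * m.+1%:R * (2 * x - n%:R + 2).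
  by rewrite k1E nE; ring.
by rewrite mulrCA pmulr_rge0 // !mulr_gt0 // ltr0n nE.
Qed.

End HalfEdges.

(** * The possible values of [f circle] *)

Lemma falling_gt0 (R : realFieldType) (x : R) m : m%:R < x ->
  0 < rising 1 x (-1) m.+1.
Proof.
move=> mx; apply: prodr_gt0 => i _; rewrite mul1n mulN1r subr_gt0.
by apply: le_lt_trans mx; rewrite ler_nat -ltnS.
Qed.

Theorem mainTheorem2 (R : realType) (f : diagram -> R)
  (f_iso : isomorphism_invariant f)
  (f_mult : multiplicative_on_diagrams f)
  (f_wrp : weakly_reflection_positive f) :
  (exists n : nat, f circle = n%:R) \/
  (exists2 n : nat, (0 < n)%N & f circle = - (2 * n)%:R).
Proof.
have [x0|x_neq0] := eqVneq (f circle) 0; first by left; exists 0%N; rewrite x0.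
have [x_lt0|x_ge0] := ltP (f circle) 0.
  right; set x := f circle in x_lt0.
  (* Large enough that [1 < k] and that the last factor [x + 2 (n - 1)] of [F_n], with [n = 2k], is
     positive; so [F_(n-1)] has the sign of [F_n]. *)
  pose k := (Num.truncn (- x)).+2.
  have xk : - x < (Num.truncn (- x)).+1%:R by apply: truncnS_gt.
  have nE : k.*2 = k.*2.-1.+1 by rewrite /k.
  have F_ge0 := even_rising_ge0 k f_iso f_mult f_wrp x_neq0.
  have G_ge0 := even_rising_pred_ge0 f_iso f_mult f_wrp x_neq0 (isT : (1 < k)%N).
  have F0 : rising 2 x 1 k.*2.-1 = 0.
    apply/eqP; rewrite eq_le; apply/andP; split.
      by move: G_ge0; rewrite -/x nmulr_lge0 //; lra.
    move: F_ge0; rewrite -/x nE /rising big_ord_recr /= pmulr_lge0 // mul1r.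
    rewrite -ltrBlDl sub0r; apply: lt_le_trans xk _; rewrite ler_nat /k; lia.
  have /prodf_eq0[i _] : rising 2 x 1 k.*2.-1 == 0 by rewrite F0.
  rewrite mul1r addr_eq0 => /eqP xE; exists i => //.
  by rewrite lt0n; apply: contraNneq x_neq0 => i0; rewrite -/x xE i0 oppr0.
left; set x := f circle in x_ge0 *; pose m := Num.truncn x.
have mx : m%:R <= x by rewrite truncn_le.
have xm : x < m.+1%:R by apply: truncnS_gt.
exists m; apply/eqP; rewrite eq_sym; move: mx; rewrite le_eqVlt => /orP[//|mx].
(* Only the last factor [x - (m + 1)] is negative. *)
have E_lt0 : rising 1 x (-1) m.+2 < 0.
  rewrite /rising big_ord_recr /= pmulr_rlt0; last exact: falling_gt0.
  by rewrite mul1n mulN1r subr_lt0.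
(* Only even [n = 2k] are available. For odd [m], [n = m + 3] makes [E_(n-1)] the negative product
   above, while [2x - n + 2 = 2x - m - 1] is positive since [x > m >= 1]. *)
have [m_odd|m_even] := boolP (odd m).
  have mE : (m.+3./2).*2 = m.+3 by rewrite -[RHS]odd_double_half /= m_odd.
  have := falling_pred_ge0 f_iso f_mult f_wrp x_neq0 (isT : (0 < m.+3./2)%N).
  rewrite -/x mE /= nmulr_rge0 //.
  have : 1 <= m%:R :> R by rewrite ler1n; case: (m) m_odd.
  by rewrite -!natr1; lra.
have mE : (m.+2./2).*2 = m.+2 by rewrite -[RHS]odd_double_half /= (negbTE m_even).
have := falling_ge0 m.+2./2 f_iso f_mult f_wrp x_neq0.
by rewrite -/x mE leNgt E_lt0.
Qed.
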